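(* Let $m$ be a positive integer and let $\alpha_1,\ldots,\alpha_m\in\mathbb{R}$. Consider the composition $$S_m:=\operatorname{Refl}(\alpha_m)\cdots\operatorname{Refl}(\alpha_2)\operatorname{Refl}(\alpha_1)$$ of $m$ classical reflectors on $\mathbb{R}^2$, and set $$\beta_m:=\alpha_m-\alpha_{m-1}\pm\cdots-(-1)^m\alpha_1=\sum_{i=1}^m(-1)^{m-i}\alpha_i.$$ Then exactly one of the following holds: (i) $m$ is odd, $S_m=\operatorname{Refl}(\beta_m)$, and $\operatorname{Fix} S_m=\mathbb{R}\,(\cos(\beta_m),\sin(\beta_m))$. (ii) $m$ is even, $S_m=\operatorname{Rot}(2\beta_m)$, and $\operatorname{Fix} S_m=\mathbb{R}^2$ if $\beta_m\in\mathbb{Z}\pi$, while $\operatorname{Fix} S_m=\{0\}$ otherwise.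
   Context: For $\alpha\in\mathbb{R}$, define the real $2\times 2$ matrices $$\operatorname{Refl}(\alpha)=\begin{pmatrix}\cos(2\alpha)&\sin(2\alpha)\\ \sin(2\alpha)&-\cos(2\alpha)\end{pmatrix},\qquad \operatorname{Rot}(\alpha)=\begin{pmatrix}\cos(\alpha)&-\sin(\alpha)\\ \sin(\alpha)&\cos(\alpha)\end{pmatrix},$$ viewed as linear operators on $\mathbb{R}^2$. ($\operatorname{Refl}(\alpha)$ is the reflector across the line $\mathbb{R}(\cos\alpha,\sin\alpha)$; such reflectors across hyperplanes through the origin are called classical reflectors.) For a map $T\colon\mathbb{R}^2\to\mathbb{R}^2$, $\operatorname{Fix} T=\{x\in\mathbb{R}^2 : Tx=x\}$. $\mathbb{R}v$ denotes $\{tv : t\in\mathbb{R}\}$, and $\mathbb{Z}\pi=\{k\pi : k\in\mathbb{Z}\}$. *)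

(* Defs.v *)
From HB Require Import structures.
From mathcomp Require Import all_boot all_order all_algebra.
From mathcomp Require Import all_classical all_reals all_analysis.

Set Implicit Arguments.
Unset Strict Implicit.
Unset Printing Implicit Defensive.

Import Order.TTheory GRing.Theory Num.Theory.
Local Open Scope classical_set_scope.
Local Open Scope ring_scope.

Definition mat2 (R : realType) (a b c d : R) : 'M[R]_2 :=
  \matrix_(i < 2, j < 2)
    if i == 0 then (if j == 0 then a else b) else (if j == 0 then c else d).

Definition vec2 (R : realType) (a b : R) : 'cV[R]_2 :=
  \col_(i < 2) if i == 0 then a else b.

Definition Refl (R : realType) (a : R) : 'M[R]_2 :=
  mat2 (cos (2 * a)) (sin (2 * a))
       (sin (2 * a)) (- cos (2 * a)).

Definition Rot (R : realType) (a : R) : 'M[R]_2 :=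
  mat2 (cos a) (- sin a)
       (sin a) (cos a).

Definition lin_op (R : realType) (A : 'M[R]_2) : 'cV[R]_2 -> 'cV[R]_2 :=
  fun x => A *m x.

Definition Fix (T : Type) (f : T -> T) : set T := [set x | f x = x].

Definition line (R : realType) (v : 'cV[R]_2) : set 'cV[R]_2 :=
  [set t *: v | t in [set: R]].

Definition Zpi (R : realType) : set R := [set k%:~R * pi | k in [set: int]].

(* The angles are indexed from 0, so alpha_i of the usual 1-based numbering is
   [alpha] at i - 1. The index is reversed because the reflector applied first,
   that of index 0, is the rightmost factor of the product. *)
Definition refl_comp (R : realType) (m : nat) (alpha : 'I_m -> R) : 'M[R]_2 :=
  \big[mulmx/1%:M]_(i < m) Refl (alpha (rev_ord i)).

Definition alt_sum (R : realType) (m : nat) (alpha : 'I_m -> R) : R :=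
  \sum_(i < m) (-1) ^+ (m - i.+1) * alpha i.

Definition exactly_one (P Q : Prop) : Prop := (P \/ Q) /\ ~ (P /\ Q).

(* Main.v *)
Require Import Defs.
From HB Require Import structures.
From mathcomp Require Import all_boot all_order all_algebra.
From mathcomp Require Import all_classical all_reals all_analysis.
From mathcomp Require Import ring.

Set Implicit Arguments.
Unset Strict Implicit.
Unset Printing Implicit Defensive.

Import Order.TTheory GRing.Theory Num.Theory.
Local Open Scope classical_set_scope.
Local Open Scope ring_scope.

(** The angle-addition formulas give [Refl a * Refl b = Rot (2 (a - b))] and
    [Refl a * Rot (2 b) = Refl (a - b)]. Thus multiplying on the left by one
    more reflector [Refl a] exchanges the two families of matrices and sends
    their parameter [b] to [a - b], which is also how the alternating sum
    changes when a new last angle [a] is appended. Starting from the empty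
    product [1 = Rot 0], induction identifies the composition
    ([refl_compE]): a reflector when the number of factors is odd, a rotation
    when it is even.

    The fixed points are read off from two factorizations. With
    [u = (cos b, sin b)], a unit vector, [Refl b = 2 u u^T - 1], so [x] is
    fixed iff [x = (u^T x) u], that is, iff [x] lies on the line through [u].
    And [Rot (2 b) - 1 = 2 sin b Rot (b + pi / 2)] is [0] when [sin b = 0] and
    invertible otherwise, while [sin b = 0] iff [b] is an integer multiple of
    [pi]. *)

(** * Products of reflectors and rotations *)

Lemma mul_mat2 (R : realType) (a b c d a' b' c' d' : R) :
  mat2 a b c d *m mat2 a' b' c' d' =
  mat2 (a * a' + b * c') (a * b' + b * d') (c * a' + d * c') (c * b' + d * d').
Proof.
apply/matrixP => i j; rewrite !mxE !big_ord_recl big_ord0 !mxE /= addr0.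
by case: ifP; case: ifP.
Qed.

Lemma mul_Rot (R : realType) (a b : R) : Rot a *m Rot b = Rot (a + b).
Proof. by rewrite mul_mat2 /Rot cosD sinD; congr mat2; ring. Qed.

Lemma Rot0 (R : realType) : Rot 0 = 1%:M :> 'M[R]_2.
Proof.
apply/matrixP => i j; rewrite !mxE cos0 sin0 oppr0.
by case: i j => [[|[|//]] ?] [[|[|//]] ?].
Qed.

Lemma mul_Refl_Refl (R : realType) (a b : R) :
  Refl a *m Refl b = Rot (2 * (a - b)).
Proof. by rewrite mul_mat2 /Rot mulrBr cosB sinB; congr mat2; ring. Qed.

Lemma mul_Refl_Rot (R : realType) (a b : R) :
  Refl a *m Rot (2 * b) = Refl (a - b).
Proof. by rewrite mul_mat2 /Refl mulrBr cosB sinB; congr mat2; ring. Qed.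

(** The last angle belongs to the reflector applied last, hence to the
    leftmost factor. *)
Lemma refl_comp_recr (R : realType) (m : nat) (alpha : 'I_m.+1 -> R) :
  refl_comp alpha =
  Refl (alpha ord_max) *m refl_comp (fun i => alpha (widen_ord (leqnSn m) i)).
Proof.
rewrite /refl_comp big_ord_recl; congr (Refl (alpha _) *m _).
  by apply: val_inj; rewrite /= subn1.
apply: eq_bigr => i _; congr (Refl (alpha _)); apply: val_inj => /=.
by rewrite /bump /= add1n subSS.
Qed.

Lemma alt_sum_recr (R : realType) (m : nat) (alpha : 'I_m.+1 -> R) :
  alt_sum alpha =
  alpha ord_max - alt_sum (fun i => alpha (widen_ord (leqnSn m) i)).
Proof.
rewrite /alt_sum big_ord_recr /= subnn expr0 mul1r addrC -sumrN.
congr (_ + _); apply: eq_bigr => i _.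
by rewrite subSn // exprS mulN1r mulNr.
Qed.

Lemma refl_compE (R : realType) (m : nat) (alpha : 'I_m -> R) :
  refl_comp alpha =
  if odd m then Refl (alt_sum alpha) else Rot (2 * alt_sum alpha).
Proof.
elim: m alpha => [|m IHm] alpha.
  by rewrite /refl_comp /alt_sum !big_ord0 mulr0 Rot0.
rewrite refl_comp_recr alt_sum_recr IHm /=.
by case: (odd m); rewrite ?mul_Refl_Refl ?mul_Refl_Rot.
Qed.

(** * Fixed points of a reflector *)

Lemma cos_double (R : realType) (b : R) :
  cos (2 * b) = cos b ^+ 2 - sin b ^+ 2.
Proof. by rewrite mulr_natl mulr2n cosD !expr2. Qed.

Lemma sin_double (R : realType) (b : R) : sin (2 * b) = 2 * sin b * cos b.
Proof. by rewrite mulr_natl mulr2n sinD; ring. Qed.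

(** [u] has norm 1, so this says that [Refl b] is twice the orthogonal
    projector [u u^T] onto its axis, minus the identity. *)
Lemma Refl_add1 (R : realType) (b : R) (u := vec2 (cos b) (sin b)) :
  Refl b + 1%:M = 2 *: (u *m u^T).
Proof.
have s2 := sin2cos2 b.
apply/matrixP => i j; rewrite !mxE big_ord1 !mxE cos_double sin_double.
case: i j => [[|[|//]] ?] [[|[|//]] ?] /=; rewrite ?mulr1n ?mulr0n; ring: s2.
Qed.

Lemma vec2_unit (R : realType) (b : R) (u := vec2 (cos b) (sin b)) :
  u^T *m u = 1%:M.
Proof.
apply/matrixP => i j.
by rewrite !ord1 !mxE !big_ord_recl big_ord0 !mxE /= addr0 -!expr2 cos2Dsin2.
Qed.

Lemma Fix_Refl (R : realType) (b : R) :
  Fix (lin_op (Refl b)) = line (vec2 (cos b) (sin b)).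
Proof.
set u := vec2 _ _.
have two_neq0 : (2 : R) != 0 by rewrite pnatr_eq0.
have fixE (x : 'cV[R]_2) : Refl b *m x = x <-> u *m (u^T *m x) = x.
  (* both sides say that [(Refl b + 1) x = 2 x] *)
  have E : Refl b *m x + x = 2 *: (u *m (u^T *m x)).
    by rewrite mulmxA scalemxAl -Refl_add1 mulmxDl mul1mx.
  have D : x + x = 2 *: x by rewrite scaler_nat mulr2n.
  split=> [fx|ux]; first by move: E; rewrite fx D => /(scalerI two_neq0).
  by apply: (addIr x); rewrite E ux D.
apply/seteqP; split=> [x /fixE <-|_ [t _ <-]].
  exists ((u^T *m x) 0 0) => //.
  by rewrite {2}[u^T *m x]mx11_scalar mul_mx_scalar.
by apply/fixE; rewrite -scalemxAr vec2_unit -scalemxAr mulmx1.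
Qed.

(** * Fixed points of a rotation *)

(** A chord of the unit circle: it has signed length [2 sin b] and points a
    quarter turn ahead of the bisecting angle [b] of its endpoints, at angles
    [0] and [2 b]. *)
Lemma Rot_sub1 (R : realType) (b : R) :
  Rot (2 * b) - 1%:M = (2 * sin b) *: Rot (b + pi / 2).
Proof.
have s2 := sin2cos2 b.
apply/matrixP => i j; rewrite !mxE cos_double sin_double cosDpihalf sinDpihalf.
case: i j => [[|[|//]] ?] [[|[|//]] ?] /=; rewrite ?mulr1n ?mulr0n; ring: s2.
Qed.

Lemma sin_intpi (R : realType) (k : int) : sin (k%:~R * pi) = 0 :> R.
Proof.
have natpi (n : nat) : sin (n%:R * pi) = 0 :> R.
  rewrite mulr_natl -[_ *+ n]add0r (alternatingn (@sinDpi R)).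
  by rewrite sin0 mulr0.
case: k => n; first exact: natpi.
by rewrite NegzE mulrNz mulNr sinN natpi oppr0.
Qed.

(** Subtracting the multiple of [pi] given by [floor (x / pi)] keeps the sine
    zero and moves the angle into [[0, pi)], where only [0] has zero sine. *)
Lemma sin_eq0 (R : realType) (x : R) : sin x = 0 <-> Zpi x.
Proof.
split=> [sx0|[k _ <-]]; last exact: sin_intpi.
set k := Num.floor (x / pi); exists k => //.
have /andP[lek ltk] : (k%:~R <= x / pi < (k + 1)%:~R)%R := floor_itv _.
rewrite ler_pdivlMr ?pi_gt0 // in lek.
rewrite ltr_pdivrMr ?pi_gt0 // intrD mulrDl mul1r -ltrBlDl in ltk.
move: lek; rewrite le_eqVlt => /predU1P[//|ltkx].
have : 0 < sin (x - k%:~R * pi) by rewrite sin_gt0_pi // subr_gt0 ltkx.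
by rewrite sinB sx0 sin_intpi mul0r mulr0 subrr ltxx.
Qed.

Lemma Fix_Rot_Zpi (R : realType) (b : R) :
  Zpi b -> Fix (lin_op (Rot (2 * b))) = [set: 'cV[R]_2].
Proof.
move=> /sin_eq0 sb0; apply/seteqP; split=> // x _; rewrite /Fix /lin_op /=.
have /eqP := Rot_sub1 b; rewrite sb0 mulr0 scale0r subr_eq0 => /eqP ->.
exact: mul1mx.
Qed.

Lemma Fix_Rot_notZpi (R : realType) (b : R) :
  ~ Zpi b -> Fix (lin_op (Rot (2 * b))) = [set 0].
Proof.
move=> nb; apply/seteqP; split=> [x fx|_ ->]; last exact: mulmx0.
have c_neq0 : 2 * sin b != 0.
  by rewrite mulf_neq0 ?pnatr_eq0 //; apply/eqP => /sin_eq0.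
have : (2 * sin b) *: (Rot (b + pi / 2) *m x) = (2 * sin b) *: 0.
  rewrite scaler0 scalemxAl -Rot_sub1 mulmxBl mul1mx; apply/eqP.
  by rewrite subr_eq0 -{2}fx.
move=> /(scalerI c_neq0) /(congr1 (mulmx (Rot (- (b + pi / 2))))).
by rewrite mulmxA mul_Rot addNr Rot0 mul1mx mulmx0.
Qed.

Theorem theorem3p2 (R : realType) (m : nat) (hm : (0 < m)%N)
    (alpha : 'I_m -> R) :
  let S := refl_comp alpha in
  let beta := alt_sum alpha in
  exactly_one
    [/\ odd m,
        S = Refl beta &
        Fix (lin_op S) = line (vec2 (cos beta) (sin beta))]
    [/\ ~~ odd m,
        S = Rot (2 * beta),
        (Zpi beta -> Fix (lin_op S) = [set: 'cV[R]_2]) &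
        (~ Zpi beta -> Fix (lin_op S) = [set 0])].
Proof.
move=> S beta; split; last by case=> -[om _ _] [/negP].
have := refl_compE alpha; rewrite -/S -/beta.
case: ifP => [om SE|/negbT om SE]; [left|right]; rewrite SE; split=> //.
- exact: Fix_Refl.
- exact: Fix_Rot_Zpi.
- exact: Fix_Rot_notZpi.
Qed.
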